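(* Let $H$ be a complex Hilbert space and $\{\mathcal{U}(t)\}_{t\geq 0}$ a strongly continuous semigroup on $H$ with generator $\mathcal{L}$. Let $z\in D(\mathcal{L})\cap D(\mathcal{L}^\dagger)$ with $z\neq 0$, let $\mathcal{P}:=(\cdot,z)(z,z)^{-1}z$ and $\mathcal{Q}:=1-\mathcal{P}$, and let $\{\mathcal{G}(t)\}_{t\geq0}$ denote the strongly continuous semigroup generated by $\overline{\mathcal{QL}}\mathcal{Q}$. Then the orbit map $\mathbb{R}_+\ni t\mapsto\mathcal{U}(t)z\in D(\mathcal{L})$ solves $$\frac{d}{dt}\mathcal{U}(t)z=\mathcal{U}(t)\mathcal{PL}z+\mathcal{G}(t)\mathcal{QL}z+\int_0^t K(t-s)\,\mathcal{U}(s)z\,ds,\qquad t\ge0,$$ where $K(t):=(\mathcal{G}(t)\mathcal{QL}z,\mathcal{Q}\mathcal{L}^\dagger z)(z,z)^{-1}$.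
   Context: The scalar product $(\cdot,\cdot)$ on $H$ is conjugate-linear in its second argument. The generator is $\mathcal{L}x:=\lim_{h\searrow 0}\frac1h[\mathcal{U}(h)x-x]$ on the set $D(\mathcal{L})$ where the limit exists. $\dagger$ denotes the adjoint, the overbar the closure of a closable operator; $D(\overline{\mathcal{QL}}\mathcal{Q})=\{x:\mathcal{Q}x\in D(\overline{\mathcal{QL}})\}$. The integral is a Bochner integral. *)

(* Defs.v *)
From HB Require Import structures.
From mathcomp Require Import all_boot all_order all_algebra.
From mathcomp Require Import all_classical all_reals all_analysis.
From mathcomp Require Export complex.
Import Order.TTheory GRing.Theory Num.Theory.
Import numFieldNormedType.Exports.

Set Implicit Arguments.
Unset Strict Implicit.
Unset Printing Implicit Defensive.

Local Open Scope ring_scope.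
Local Open Scope classical_set_scope.
Local Open Scope complex_scope.

Section Defs.
Variables (R : realType) (V : normedModType R[i]).

Definition inner_product (ip : V -> V -> R[i]) : Prop :=
  [/\ forall (a : R[i]) (x y w : V), ip (a *: x + y) w = a * ip x w + ip y w,
      forall x y : V, ip y x = (ip x y)^*
    & forall x : V, `|x| ^+ 2 = ip x x].

(** Strongly continuous (C_0) semigroup {U(t)}_{t >= 0} of bounded linear
    operators on V (values at t < 0 are irrelevant). *)
Definition C0_semigroup (U : R -> V -> V) : Prop :=
  [/\ forall t, 0 <= t -> forall (a : R[i]) (x y : V),
        U t (a *: x + y) = a *: U t x + U t y,
      forall t, 0 <= t -> continuous (U t),
      forall x, U 0 x = x,
      forall s t x, 0 <= s -> 0 <= t -> U (s + t) x = U s (U t x)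
    & forall x, U t x @[t --> at_right 0] --> x].

(** Unbounded operators are represented by their graphs: A x y means
    x \in D(A) and A x = y. *)
Definition opgraph := V -> V -> Prop.

Definition generator (U : R -> V -> V) : opgraph :=
  fun x y => ((h^-1)%:C *: (U h x - x)) @[h --> at_right 0] --> y.

Definition adjoint (ip : V -> V -> R[i]) (A : opgraph) : opgraph :=
  fun y w => forall x v, A x v -> ip v y = ip x w.

Definition op_closure (A : opgraph) : opgraph :=
  fun x y => closure [set p : V * V | A p.1 p.2] (x, y).

Definition projP (ip : V -> V -> R[i]) (z : V) (x : V) : V :=
  (ip x z / ip z z) *: z.
Definition projQ (ip : V -> V -> R[i]) (z : V) (x : V) : V :=
  x - projP ip z x.

Definition opQL (ip : V -> V -> R[i]) (z : V) (L : opgraph) : opgraph :=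
  fun x y => exists v, L x v /\ y = projQ ip z v.

Definition opQLbarQ (ip : V -> V -> R[i]) (z : V) (L : opgraph) : opgraph :=
  fun x y => op_closure (opQL ip z L) (projQ ip z x) y.

(** Two-sided (one-sided at t = 0) derivative of f : [0, oo) -> V at t >= 0. *)
Definition has_deriv_nonneg (f : R -> V) (t : R) (v : V) : Prop :=
  ((h^-1)%:C *: (f (t + h) - f t))
    @[h --> within [set h : R | h != 0 /\ 0 <= t + h] (nbhs (0 : R))] --> v.

(** Integral over [0, t] of a continuous V-valued function, as the limit of
    Riemann sums on uniform partitions (coincides with the Bochner integral
    for continuous integrands). *)
Definition riemann_sum (f : R -> V) (t : R) (n : nat) : V :=
  ((t / n.+1%:R)%:C) *: \sum_(k < n.+1) f (k%:R * t / n.+1%:R).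

Definition integral_0t_is (f : R -> V) (t : R) (I : V) : Prop :=
  riemann_sum f t n @[n --> \oo] --> I.

End Defs.

(* Main.v *)
(** Since (Lx, z) = (x, Ldz) for x in D(L), the operator PL is bounded on D(L), so
    QL is already closed and, on vectors orthogonal to z, the generator of G is
    L - B with B x = (x, Q Ldz)(z, z)^-1 z.  For x in D(L) orthogonal to z the
    orbit G(s)x stays orthogonal to z, and F(s) = U(s) G(t - s) x satisfies
    F'(s) = U(s) B G(t - s) x = K_x(t - s) U(s) z, which is continuous; hence the
    Riemann sums of the memory integral converge to F(t) - F(0) = U(t)x - G(t)x.
    Both sides are bounded in x, so this extends to x = QLz, which is the limit of
    Q (U(h)z - z)/h; the claim is then U(t)Lz = U(t)PLz + U(t)QLz. *)
Require Import Defs.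
From mathcomp Require Import all_boot all_order all_algebra.
From mathcomp Require Import all_classical all_reals all_analysis.
From mathcomp Require Import complex lra ring.
Import Order.TTheory GRing.Theory Num.Theory.
Import numFieldNormedType.Exports.

Set Implicit Arguments.
Unset Strict Implicit.
Unset Printing Implicit Defensive.

Local Open Scope ring_scope.
Local Open Scope classical_set_scope.
Local Open Scope complex_scope.

(** * Real-valued norms and epsilon-delta forms of limits *)

Lemma Re_norm_ge0 (R : realType) (c : R[i]) : 0 <= complex.Re `|c|.
Proof. by have := normr_ge0 c; rewrite lecE => /andP[]. Qed.

Section RealNorm.
Context {R : realType} {V : normedModType R[i]}.
Implicit Types (x y : V) (a : R).

(** The norm of [V] takes values in [R[i]]; its real part carries the same information and allows
    linear arithmetic over [R]. *)
Definition rnorm x : R := complex.Re `|x|.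

Lemma ge0_complexE (c : R[i]) : 0 <= c -> c = (complex.Re c)%:C.
Proof. by case: c => u v; rewrite lecE /= => /andP[/eqP -> _]. Qed.

Lemma normE x : `|x| = (rnorm x)%:C.
Proof. exact: ge0_complexE (normr_ge0 x). Qed.

Lemma rnorm_ge0 x : 0 <= rnorm x.
Proof. by have := normr_ge0 x; rewrite normE lecR. Qed.

Lemma rnorm0 : rnorm 0 = 0.
Proof. by rewrite /rnorm normr0. Qed.

Lemma rnorm0_eq0 x : rnorm x = 0 -> x = 0.
Proof. by move=> h; apply/normr0_eq0; rewrite normE h. Qed.

Lemma rnormD x y : rnorm (x + y) <= rnorm x + rnorm y.
Proof. by have := ler_normD x y; rewrite !normE -rmorphD lecR. Qed.

Lemma rnormN x : rnorm (- x) = rnorm x.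
Proof. by rewrite /rnorm normrN. Qed.

Lemma rnormB x y : rnorm (x - y) <= rnorm x + rnorm y.
Proof. by rewrite -(rnormN y) rnormD. Qed.

Lemma rnorm_distC x y : rnorm (x - y) = rnorm (y - x).
Proof. by rewrite -rnormN opprB. Qed.

Lemma rnorm_distD y x w : rnorm (x - w) <= rnorm (x - y) + rnorm (y - w).
Proof. by rewrite -[x - w](subrKA y) rnormD. Qed.

Lemma rnormZ (c : R[i]) x : rnorm (c *: x) = complex.Re `|c| * rnorm x.
Proof.
by rewrite {1}/rnorm normrZ normE (ge0_complexE (normr_ge0 c)) -rmorphM.
Qed.

Lemma Re_normR a : complex.Re `|a%:C| = `|a|.
Proof. by rewrite normc_def /= expr0n /= addr0 sqrtr_sqr. Qed.

Lemma rnormZr a x : rnorm (a%:C *: x) = `|a| * rnorm x.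
Proof. by rewrite rnormZ Re_normR. Qed.

Lemma rnorm_sum n (F : 'I_n -> V) : rnorm (\sum_(k < n) F k) <= \sum_(k < n) rnorm (F k).
Proof.
elim/big_rec2: _ => [|k r v _ ih]; first by rewrite rnorm0.
by rewrite (le_trans (rnormD _ _))// lerD2l.
Qed.

(** A positive element of [R[i]] has zero imaginary part, so real tolerances suffice. *)
Lemma cvg_rnormP (T : Type) (F : set_system T) (FF : Filter F) (f : T -> V) l :
  f @ F --> l <-> forall e : R, 0 < e -> \forall t \near F, rnorm (f t - l) <= e.
Proof.
rewrite cvgrPdistC_le; split=> [h e e0|h [e e']].
- have /h : 0 < e%:C :> R[i] by rewrite ltcR.
  by apply: filterS => t; rewrite normE lecR.
- rewrite ltcE /= => /andP[/eqP -> /h].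
  by apply: filterS => t; rewrite normE lecR.
Qed.

Lemma near_at_right0P (P : R -> Prop) :
  (\forall h \near at_right 0, P h) <->
  exists2 d : R, 0 < d & forall h, 0 < h -> h < d -> P h.
Proof.
split=> [[e /= e0 he]|[d d0 hd]].
- exists e => // h h0 hlt; apply: he => //=.
  by rewrite sub0r normrN gtr0_norm.
- exists d => //= h /=; rewrite sub0r normrN => hlt h0.
  by apply: hd => //; rewrite -(gtr0_norm h0).
Qed.

Lemma cvg_at_right0P (f : R -> V) l :
  f h @[h --> at_right 0] --> l <->
  forall e : R, 0 < e -> exists2 d : R, 0 < d &
    forall h, 0 < h -> h < d -> rnorm (f h - l) <= e.
Proof.
rewrite cvg_rnormP; split=> h e /h; by move/near_at_right0P.
Qed.

End RealNorm.

Lemma continuous_rnormP (R : realType) (V W : normedModType R[i]) (f : V -> W) (x : V) :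
  {for x, continuous f} <->
  forall e : R, 0 < e -> exists2 d : R, 0 < d &
    forall y, rnorm (y - x) < d -> rnorm (f y - f x) <= e.
Proof.
rewrite /prop_for /continuous_at cvg_rnormP; split=> h e e0.
- have /nbhs_normP[[d d'] /=] := h e e0.
  rewrite ltcE /= => /andP[/eqP -> d0] hd; exists d => // y hy; apply: hd.
  by rewrite /= distrC normE ltcR.
- have [d d0 hd] := h e e0; apply/nbhs_normP.
  exists d%:C => /=; first by rewrite ltcR.
  by move=> y /=; rewrite distrC normE ltcR; exact: hd.
Qed.

(** * Nested balls in a complete space *)

Section Completeness.
Context {R : realType} {V : completeNormedModType R[i]}.

(* Baire's argument: a point is found in the intersection of nested balls. *)
Lemma nested_balls (P : nat -> V -> Prop) :
  (forall n x (r : R), 0 < r -> exists x' (r' : R),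
     [/\ 0 < r', r' <= r / 2, rnorm (x' - x) + r' <= r &
         forall y, rnorm (y - x') <= r' -> P n y]) ->
  exists x, forall n, P n x.
Proof.
move=> step.
(* The requirements are conditional on a positive radius, which makes the choice function total;
   otherwise any pair serves. *)
have /choice[f hf] : forall q : nat * V * R, exists q' : V * R, 0 < q.2 ->
    [/\ 0 < q'.2, q'.2 <= q.2 / 2, rnorm (q'.1 - q.1.2) + q'.2 <= q.2 &
         forall y, rnorm (y - q'.1) <= q'.2 -> P q.1.1 y].
  move=> [[n x] r] /=; have [r0|r0] := ltP 0 r.
    by have [x' [r' h]] := step n x r r0; exists (x', r').
  by exists (x, r).
pose u := fix u n : V * R := if n is m.+1 then f (m, (u m).1, (u m).2) else (0, 1).
have u0 n : 0 < (u n).2.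
  by elim: n => //= n ih; case: (hf (n, (u n).1, (u n).2) ih).
have uS n := hf (n, (u n).1, (u n).2) (u0 n).
have ur n : (u n).2 <= (2 ^+ n)^-1.
  elim: n => [|n ih]; first by rewrite expr0 invr1.
  have [_ h _ _] := uS n; apply: le_trans h _.
  by rewrite exprS invfM mulrC ler_pM2l ?invr_gt0.
have ub n m : rnorm ((u (n + m)%N).1 - (u n).1) + (u (n + m)%N).2 <= (u n).2.
  elim: m => [|m ih]; first by rewrite addn0 subrr rnorm0 add0r.
  rewrite addnS; have [_ _ h _] := uS (n + m)%N.
  have := rnorm_distD (u (n + m)%N).1 (u (n + m).+1).1 (u n).1.
  move: h ih => /=; lra.
have ub' n m : (n <= m)%N -> rnorm ((u m).1 - (u n).1) <= (u n).2.
  move=> /subnKC <-; have := ub n (m - n)%N; have := u0 (n + (m - n))%N; lra.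
have small (e : R) : 0 < e -> exists n, (u n).2 < e.
  move=> e0.
  have h2 : `|2^-1 : R| < 1 by rewrite ger0_norm ?invr_ge0// invf_lt1 // ltr1n.
  have /cvgrPdist_lt/(_ _ e0)[n _ hn] := cvg_expr h2.
  exists n; apply: le_lt_trans (ur n) _.
  by have := hn n (leqnn n); rewrite /= sub0r normrN exprVn ger0_norm ?invr_ge0 ?exprn_ge0.
have /cvg_ex[x hx] : cvg ((fun n => (u n).1) @ \oo).
  apply: cauchy_cvg; apply: cauchy_exP => -[e e'].
  rewrite ltcE /= => /andP[/eqP -> e0].
  have [n hn] := small e e0; exists (u n).1; exists n => // m /= nm.
  rewrite -ball_normE /= distrC normE ltcR.
  exact: le_lt_trans (ub' _ _ nm) hn.
(* All later centres lie in the closed ball of index [n.+1], hence so does their limit. *)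
exists x => n; have [_ _ _] := uS n; apply.
apply/ler_addgt0Pr => e e0.
have /cvg_rnormP/(_ e e0)[k _ hk] := hx.
have := hk (maxn k n.+1) (leq_maxl _ _).
have := ub' n.+1 (maxn k n.+1) (leq_maxr _ _).
have := rnorm_distD (u (maxn k n.+1)).1 x (u n.+1).1.
rewrite (rnorm_distC x (u (maxn k n.+1)).1) /=; lra.
Qed.

End Completeness.

Lemma subrACA (V : zmodType) (x y z t : V) : (x - y) - (z - t) = (x - z) - (y - t).
Proof. by rewrite !opprB [t - z]addrC addrACA [- y + t]addrC. Qed.

(** * A mean value inequality for vector-valued functions *)

Section MeanValue.
Context {R : realType} {V : normedModType R[i]}.
Implicit Types (f : R -> V) (a b s : R) (u v : V).

(** Division-free form of the derivative relative to [[a, b]]: it is one-sided at the endpoints and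
    allows [r = s]. *)
Definition deriv_on a b f s v : Prop :=
  forall e : R, 0 < e -> exists2 d : R, 0 < d &
    forall r, a <= r <= b -> `|r - s| < d ->
      rnorm (f r - f s - (r - s)%:C *: v) <= e * `|r - s|.

(** The first-order expansions at [r] and [r'] about [s] are subtracted; their errors add up to a
    multiple of [r' - r] because [s] lies between the two points. *)
Lemma deriv_on_straddle a b f s v (e : R) : deriv_on a b f s v -> 0 < e ->
  exists2 d : R, 0 < d & forall r r', a <= r -> r <= s -> s <= r' -> r' <= b ->
    s - d < r -> r' < s + d ->
    rnorm (f r' - f r - (r' - r)%:C *: v) <= e * (r' - r).
Proof.
move=> fs e0; have [d d0 hd] := fs e e0; exists d => // r r' ar rs sr' r'b dr r'd.
have h1 : rnorm (f r' - f s - (r' - s)%:C *: v) <= e * `|r' - s|.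
  by apply: hd; [lra|rewrite ger0_norm; lra].
have h2 : rnorm (f r - f s - (r - s)%:C *: v) <= e * `|r - s|.
  by apply: hd; [lra|rewrite ler0_norm; lra].
have -> : f r' - f r - (r' - r)%:C *: v =
    (f r' - f s - (r' - s)%:C *: v) - (f r - f s - (r - s)%:C *: v).
  rewrite [RHS]subrACA [X in _ = X - _]subrACA subrr subr0 -scalerBl -rmorphB.
  by congr (_ - _%:C *: _); ring.
apply: le_trans (rnormB _ _) _.
rewrite ger0_norm in h1; last lra.
rewrite ler0_norm in h2; last lra.
lra.
Qed.

(** A supremum argument with slack [e]: if the set of good points had its supremum below [b],
    differentiability there would produce a good point beyond it. *)
Lemma mean_value_affine a b f u (c : R) : a <= b ->
  (forall s, a <= s <= b -> exists2 v, deriv_on a b f s v & rnorm (v - u) <= c) ->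
  rnorm (f b - f a - (b - a)%:C *: u) <= c * (b - a).
Proof.
move=> ab fd; apply/ler_addgt0Pr => e' e'0.
(* The summand 1 keeps the denominator positive when [a = b]. *)
pose e := e' / (b - a + 1).
have e0 : 0 < e by rewrite divr_gt0 //; lra.
have ee' : e * (b - a) <= e'.
  rewrite /e -mulrA ger_pMr // mulrC ler_pdivrMr; lra.
apply: (@le_trans _ _ ((c + e) * (b - a))); last by rewrite mulrDl; lra.
pose S := [set s : R | a <= s <= b /\
  rnorm (f s - f a - (s - a)%:C *: u) <= (c + e) * (s - a)].
have Sa : S a.
  split; first by rewrite lexx.
  by rewrite !subrr scale0r subrr rnorm0 mulr0.
have supS : has_sup S.
  by split; [exists a|exists b => s [/andP[]]].
pose m := sup S.
have am : a <= m by exact: (sup_upper_bound supS Sa).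
have mb : m <= b by apply: ge_sup; [exists a|move=> s [/andP[]]].
have [|v fm vu] := fd m; first by rewrite am.
have [d d0 hd] := deriv_on_straddle fm e0.
have [r Sr mr] := sup_adherent d0 supS.
have rm : r <= m by exact: (sup_upper_bound supS Sr).
case: Sr => /andP[ar rb] hr.
(* The straddle estimate starts from a good point [r] just below [m], so it covers [r' = m] as well
   as points past [m]. *)
have Sr' r' : m <= r' -> r' <= b -> r' < m + d -> S r'.
  move=> mr' r'b r'd; split; first by apply/andP; split; lra.
  have -> : f r' - f a - (r' - a)%:C *: u =
      (f r' - f r - (r' - r)%:C *: v) + (r' - r)%:C *: (v - u) +
      (f r - f a - (r - a)%:C *: u).
    rewrite scalerBr subrKA [RHS]addrACA subrKA -opprD -scalerDl -rmorphD.
    by congr (_ - _%:C *: _); ring.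
  apply: le_trans (rnormD _ _) _.
  have h1 := hd r r' ar rm mr' r'b mr r'd.
  have h2 := rnormD (f r' - f r - (r' - r)%:C *: v) ((r' - r)%:C *: (v - u)).
  rewrite rnormZr ger0_norm in h2; last lra.
  have h3 : (r' - r) * rnorm (v - u) <= (r' - r) * c.
    by rewrite ler_wpM2l //; lra.
  move: h1 h2 h3 hr; rewrite /=; lra.
have [mltb|] := ltP m b; last first.
  by move=> bm; have [] : S b by apply: Sr' => //; lra.
pose r' := Num.min b (m + d / 2).
have r'b : r' <= b by rewrite ge_min lexx.
have r'm : r' <= m + d / 2 by rewrite ge_min lexx orbT.
have mr' : m < r' by rewrite lt_min mltb /=; lra.
have : S r' by apply: Sr' => //; lra.
move/(sup_upper_bound supS); rewrite -/m; lra.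
Qed.

End MeanValue.

(** * Strongly continuous semigroups and their generators *)

Section Semigroup.
Context {R : realType} {V : completeNormedModType R[i]}.
Variables (U : R -> V -> V) (hU : C0_semigroup U).
Implicit Types (x y : V) (s t h e : R).

Let U0 x : U 0 x = x. Proof. by case: hU. Qed.

Lemma semigroupSD s t x : 0 <= s -> 0 <= t -> U (s + t) x = U s (U t x).
Proof. by case: hU => _ _ _ h _; exact: h. Qed.

Lemma semigroupD t x y : 0 <= t -> U t (x + y) = U t x + U t y.
Proof. by case: hU => h _ _ _ _ t0; have := h t t0 1 x y; rewrite !scale1r. Qed.

Lemma semigroup0 t : 0 <= t -> U t 0 = 0.
Proof. by move=> t0; apply: (addrI (U t 0)); rewrite -semigroupD // !addr0. Qed.

Lemma semigroupZ t (a : R[i]) x : 0 <= t -> U t (a *: x) = a *: U t x.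
Proof.
case: hU => h _ _ _ _ t0; have := h t t0 a x 0.
by rewrite !addr0 semigroup0 // addr0.
Qed.

Lemma semigroupB t x y : 0 <= t -> U t (x - y) = U t x - U t y.
Proof. by move=> t0; rewrite semigroupD // -scaleN1r semigroupZ // scaleN1r. Qed.

Lemma semigroup_cvg x e : 0 < e ->
  exists2 d : R, 0 < d & forall h, 0 <= h -> h < d -> rnorm (U h x - x) <= e.
Proof.
case: hU => _ _ _ _ /(_ x)/cvg_at_right0P h e0.
have [d d0 hd] := h e e0; exists d => // h'; rewrite le_eqVlt => /orP[/eqP <- _|].
  by rewrite U0 subrr rnorm0 ltW.
exact: hd.
Qed.

(* Uniform boundedness near 0: otherwise every ball contains a smaller ball on
   which some U h with h < 1/(n+1) exceeds n, which contradicts strong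
   continuity at a common point of such balls. *)
Lemma semigroup_bounded_near0 : exists d M : R, [/\ 0 < d, 1 <= M &
  forall h x, 0 <= h -> h < d -> rnorm (U h x) <= M * rnorm x].
Proof.
apply: contrapT => unb.
have {}unb d M : 0 < d -> 1 <= M -> exists h x,
    [/\ 0 <= h, h < d & M * rnorm x < rnorm (U h x)].
  move=> d0 M1; apply: contrapT => nex; apply: unb; exists d, M; split=> // h x h0 hd.
  by rewrite leNgt; apply/negP => lt; apply: nex; exists h, x.
have [|x hx] := @nested_balls R V (fun n y => exists h,
    [/\ 0 <= h, h < n.+1%:R^-1 & n%:R < rnorm (U h y)]).
  move=> n x r r0.
  (* With this [M], the multiple [w] of [v] of norm [r / 4] satisfies [rnorm (U h w) > n + 1]. *)
  pose M := 1 + 4 * n.+1%:R / r.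
  have M1 : 1 <= M by rewrite lerDl divr_ge0 ?mulr_ge0 // ltW.
  have n0 : 0 < n.+1%:R^-1 :> R by rewrite invr_gt0.
  have [h [v [h0 hn hv]]] := unb n.+1%:R^-1 M n0 M1.
  have v0 : 0 < rnorm v.
    rewrite lt_def rnorm_ge0 andbT; apply: contraL hv => /eqP/rnorm0_eq0 ->.
    by rewrite semigroup0 // rnorm0 mulr0 ltxx.
  pose w := (r / 4 / rnorm v)%:C *: v.
  have c0 : 0 < r / 4 / rnorm v by rewrite !divr_gt0.
  have wr : rnorm w = r / 4.
    by rewrite /w rnormZr gtr0_norm // divfK // gt_eqF.
  have Uw : n.+1%:R < rnorm (U h w).
    rewrite /w semigroupZ // rnormZr gtr0_norm //.
    apply: lt_trans (_ : r / 4 / rnorm v * (M * rnorm v) < _).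
      rewrite mulrCA divfK ?gt_eqF // /M mulrDl mul1r.
      have -> : 4 * n.+1%:R / r * (r / 4) = n.+1%:R by field; rewrite gt_eqF.
      lra.
    by rewrite ltr_pM2l.
  (* Since [2 U h w = U h (x + w) - U h (x - w)], one of the two points [x + w] and [x - w] has an
     image of norm above [n + 1]. *)
  have [y xy Uy] : exists2 y, rnorm (y - x) = r / 4 & n.+1%:R < rnorm (U h y).
    have [le1|lt1] := leP (rnorm (U h (x + w))) n.+1%:R; last first.
      by exists (x + w) => //; rewrite addrAC subrr add0r.
    exists (x - w); first by rewrite addrAC subrr add0r rnormN.
    have : rnorm (U h w + U h w) <= rnorm (U h (x + w)) + rnorm (U h (x - w)).
      rewrite -[U h w + U h w](_ : U h (x + w) - U h (x - w) = _) ?rnormB //.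
      by rewrite semigroupD // semigroupB // opprB addrC subrKA.
    have -> : U h w + U h w = 2%:C *: U h w by rewrite rmorphMn /= scaler_nat.
    rewrite rnormZr ger0_norm //; lra.
  have [d d0 hd] : exists2 d : R, 0 < d &
      forall y', rnorm (y' - y) < d -> rnorm (U h y' - U h y) <= 1.
    by case: hU => _ /(_ h h0 y)/continuous_rnormP c _ _ _; exact: c.
  (* The half [r / 2] fits the ball into the old one, as [y] is at distance [r / 4] from [x]; the
     half [d / 2] lets [U h] vary by at most 1, which leaves norms above [n]. *)
  exists y, (Num.min (r / 2) (d / 2)).
  have m1 : Num.min (r / 2) (d / 2) <= r / 2 by rewrite ge_min lexx.
  have m2 : Num.min (r / 2) (d / 2) <= d / 2 by rewrite ge_min lexx orbT.
  split=> //; [by rewrite lt_min !divr_gt0|by rewrite xy; lra|].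
  move=> y' y'y; exists h; split=> //.
  have h1 : rnorm (U h y' - U h y) <= 1 by apply: hd; lra.
  have := rnorm_distD (U h y') (U h y) 0.
  rewrite !subr0 rnorm_distC; rewrite -natr1 in Uy; lra.
have [d d0 hd] := semigroup_cvg x (ltr01 : 0 < 1 :> R).
(* The term [d^-1] forces [h < d], so [rnorm (U h x)] is at most [1 + rnorm x], which the other two
   terms keep below [n]. *)
pose n := Num.bound (d^-1 + 1 + rnorm x).
have hn : d^-1 + 1 + rnorm x < n%:R.
  by apply: archi_boundP; rewrite !addr_ge0 ?rnorm_ge0 // invr_ge0 ltW.
have [h [h0 hlt hh]] := hx n.
have hd' : h < d.
  apply: lt_le_trans hlt _; rewrite -[leRHS]invrK lef_pV2 ?posrE ?invr_gt0 //.
  have := rnorm_ge0 x; rewrite -natr1; lra.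
have := hd h h0 hd'; have := rnorm_distD x (U h x) 0; rewrite !subr0.
have : 0 < d^-1 by rewrite invr_gt0.
lra.
Qed.

(** The interval is covered by [k] steps of length [d / 2], each costing a factor [M]; as [M >= 1],
    fewer steps obey the same bound. *)
Lemma semigroup_bounded T : exists2 M : R, 1 <= M &
  forall s x, 0 <= s <= T -> rnorm (U s x) <= M * rnorm x.
Proof.
have [d [M [d0 M1 hM]]] := semigroup_bounded_near0.
have M0 : 0 <= M by lra.
have bk (k : nat) s x : 0 <= s -> s <= k%:R * (d / 2) -> rnorm (U s x) <= M ^+ k * rnorm x.
  elim: k s x => [|k ih] s x s0.
    rewrite mul0r => s0'; have -> : s = 0 by apply/eqP; rewrite eq_le s0 s0'.
    by rewrite U0 expr0 mul1r.
  rewrite -natr1 mulrDl mul1r => sk.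
  have [sd|ds] := leP s (d / 2).
    apply: le_trans (hM s x s0 _) _; first lra.
    by rewrite ler_wpM2r ?rnorm_ge0 // exprS ler_peMr // exprn_ege1.
  have -> : s = d / 2 + (s - d / 2) by lra.
  rewrite semigroupSD; try lra.
  apply: le_trans (hM _ _ _ _) _; try lra.
  by rewrite exprS -mulrA ler_wpM2l // ih //; lra.
pose k := Num.bound (T / (d / 2)).
exists (M ^+ k); first by rewrite exprn_ege1.
move=> s x /andP[s0 sT]; apply: bk => //.
have T0 : 0 <= T by lra.
apply: (le_trans sT); rewrite -ler_pdivrMr ?divr_gt0 //.
apply: ltW; apply: archi_boundP; rewrite divr_ge0 //; lra.
Qed.

(** For [s <= r], [U r x - U s x = U s (U (r - s) x - x)], so continuity at 0 and the bound on
    [[0, T]] give a modulus independent of the base point. *)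
Lemma orbit_unif_continuous T x e : 0 < e -> exists2 d : R, 0 < d &
  forall r s, 0 <= r <= T -> 0 <= s <= T -> `|r - s| < d -> rnorm (U r x - U s x) <= e.
Proof.
move=> e0; have [M M1 hM] := semigroup_bounded T.
have [|d d0 hd] := @semigroup_cvg x (e / M); first by rewrite divr_gt0 //; lra.
exists d => // r s; wlog sr : r s / s <= r => [hw hr hs rs|].
  have [|/ltW] := leP s r; first by move/hw; apply.
  by move/hw => h; rewrite rnorm_distC; apply: h => //; rewrite distrC.
move=> /andP[r0 rT] /andP[s0 sT]; rewrite ger0_norm; last lra.
move=> rsd; have -> : r = s + (r - s) by lra.
rewrite semigroupSD -?semigroupB; try lra.
apply: le_trans (hM _ _ _) _; first by rewrite s0.
rewrite mulrC -ler_pdivlMr; last lra.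
by apply: hd; lra.
Qed.

Lemma generatorP x y : generator U x y <->
  forall e, 0 < e -> exists2 d : R, 0 < d &
    forall h, 0 <= h -> h < d -> rnorm (U h x - x - h%:C *: y) <= e * h.
Proof.
rewrite /generator cvg_at_right0P.
have eqv h : 0 < h -> rnorm ((h^-1)%:C *: (U h x - x) - y) =
    h^-1 * rnorm (U h x - x - h%:C *: y).
  move=> h0; rewrite -[in RHS](gtr0_norm (_ : 0 < h^-1)) ?invr_gt0 // -rnormZr.
  by rewrite [in RHS]scalerBr scalerA -rmorphM mulVf ?gt_eqF // scale1r.
split=> H e e0; have [d d0 hd] := H e e0; exists d => // h h0 hlt.
  move: h0; rewrite le_eqVlt => /orP[/eqP <-|h0].
    by rewrite U0 subrr scale0r subrr rnorm0 mulr0.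
  by have := hd h h0 hlt; rewrite eqv // ler_pdivrMl // mulrC.
by rewrite eqv // ler_pdivrMl // mulrC; apply: hd => //; exact: ltW.
Qed.

(** To the right of [s], [U s] is applied to the expansion at 0. To the left, [U r] is applied
    instead, and [U r y] is then replaced by [U s y] using continuity of the orbit of [y]. *)
Lemma orbit_deriv T x y s : generator U x y -> 0 <= s <= T ->
  deriv_on 0 T (fun r => U r x) s (U s y).
Proof.
move=> /generatorP gx sT e e0; have [M M1 hM] := semigroup_bounded T.
have [|d1 d10 hd1] := gx (e / 2 / M); first by rewrite !divr_gt0 //; lra.
have [|d2 d20 hd2] := @orbit_unif_continuous T y (e / 2); first by rewrite divr_gt0.
have hd1' q h : 0 <= q <= T -> 0 <= h -> h < d1 ->
    rnorm (U q (U h x - x - h%:C *: y)) <= e / 2 * h.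
  move=> hq h0 hh; apply: le_trans (hM _ _ hq) _.
  rewrite mulrC -ler_pdivlMr; last lra.
  by rewrite mulrAC; exact: hd1.
exists (Num.min d1 d2); first by rewrite lt_min d10.
move=> r rT; rewrite lt_min => /andP[rd1 rd2].
have [sr|/ltW rs] := leP s r.
  rewrite ger0_norm in rd1 *; try lra.
  have h1 : rnorm (U s (U (r - s) x - x - (r - s)%:C *: y)) <= e / 2 * (r - s).
    by apply: hd1' => //; lra.
  rewrite !semigroupB ?semigroupZ -?semigroupSD in h1; try lra.
  have sE : s + (r - s) = r by lra.
  rewrite sE in h1; apply: le_trans h1 _; rewrite ler_wpM2r //; lra.
rewrite ler0_norm in rd1 *; try lra.
have h1 : rnorm (U r (U (s - r) x - x - (s - r)%:C *: y)) <= e / 2 * (s - r).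
  by apply: hd1' => //; lra.
rewrite !semigroupB ?semigroupZ -?semigroupSD in h1; try lra.
have rE : r + (s - r) = s by lra.
rewrite rE in h1.
have h2 : rnorm ((s - r)%:C *: (U r y - U s y)) <= e / 2 * (s - r).
  rewrite rnormZr ger0_norm 1?mulrC ?ler_wpM2r //; try lra.
  exact: hd2.
rewrite rnorm_distC opprB addrC -[r - s]opprB rmorphN scaleNr opprK.
rewrite -(subrKA ((s - r)%:C *: U r y)) -scalerBr.
apply: le_trans (rnormD _ _) _; lra.
Qed.

Lemma generator_invariant t x y : 0 <= t -> generator U x y -> generator U (U t x) (U t y).
Proof.
move=> t0 /generatorP gx; apply/generatorP => e e0.
have [M M1 hM] := semigroup_bounded t.
have [|d d0 hd] := gx (e / M); first by rewrite !divr_gt0 //; lra.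
exists d => // h h0 hlt.
rewrite -semigroupSD // (addrC h t) semigroupSD // -semigroupZ // -!semigroupB //.
apply: le_trans (hM _ _ _) _; first by rewrite t0 lexx.
rewrite mulrC -ler_pdivlMr; last lra.
by rewrite mulrAC; exact: hd.
Qed.

(** The mean value inequality on [[0, h]] bounds the remainder of an approximating pair in terms of
    the orbit of [y], with an admissible [h] that does not depend on the pair; the approximation
    error is then sent to 0. *)
Lemma generator_closed x y :
  (forall e, 0 < e -> exists x' y',
     [/\ generator U x' y', rnorm (x' - x) <= e & rnorm (y' - y) <= e]) ->
  generator U x y.
Proof.
move=> app; apply/generatorP => e e0.
have [M M1 hM] := semigroup_bounded 1.
have [d d0 hd] := semigroup_cvg y e0.
exists (Num.min d 1); first by rewrite lt_min d0 ltr01.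
move=> h h0; rewrite lt_min => /andP[hd' h1].
apply/ler_addgt0Pr => e' e'0.
(* As [h < 1], the total error is at most [M n + (M n + n)], which is below [2 (M + 1) n = e']. *)
pose n := e' / (2 * (M + 1)).
have n0 : 0 < n by rewrite divr_gt0 // mulr_gt0; lra.
have [x' [y' [g' xn yn]]] := app n n0.
have key : rnorm (U h x' - U 0 x' - (h - 0)%:C *: y) <= (e + M * n) * (h - 0).
  apply: (@mean_value_affine _ _ 0 h (fun s => U s x')) => // s /andP[s0 sh].
  exists (U s y'); first by apply: orbit_deriv => //; rewrite s0.
  apply: le_trans (rnorm_distD (U s y) _ _) _.
  rewrite -semigroupB // addrC lerD //; first by apply: hd => //; lra.
  apply: le_trans (hM _ _ _) _; first by rewrite s0; lra.
  by rewrite ler_wpM2l //; lra.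
rewrite subr0 U0 in key.
have -> : U h x - x - h%:C *: y =
    (U h x' - x' - h%:C *: y) - (U h (x' - x) - (x' - x)).
  by rewrite semigroupB // [X in _ = _ - X]subrACA [RHS]subrACA subrr sub0r opprB.
apply: le_trans (rnormB _ _) _.
have h2 : rnorm (U h (x' - x)) <= M * n.
  apply: le_trans (hM _ _ _) _; first by rewrite h0 ltW.
  by rewrite ler_wpM2l //; lra.
have h3 := rnormB (U h (x' - x)) (x' - x).
have h4 : M * n * h <= M * n * 1.
  by rewrite ler_wpM2l ?(ltW h1) // mulr_ge0; lra.
have h5 : 2 * (M + 1) * n = e' by rewrite /n mulrC divfK //; lra.
lra.
Qed.

Lemma generator_linear (a : R[i]) x y v w : generator U x v -> generator U y w ->
  generator U (a *: x + y) (a *: v + w).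
Proof.
move=> /generatorP gx /generatorP gy; apply/generatorP => e e0.
have a0 : 0 <= complex.Re `|a| by exact: Re_norm_ge0.
have a1 : 0 < complex.Re `|a| + 1 by lra.
have [|d1 d10 hd1] := gx (e / 2 / (complex.Re `|a| + 1)); first by rewrite !divr_gt0.
have [|d2 d20 hd2] := gy (e / 2); first by rewrite divr_gt0.
exists (Num.min d1 d2); first by rewrite lt_min d10.
move=> h h0; rewrite lt_min => /andP[hlt1 hlt2].
have -> : U h (a *: x + y) - (a *: x + y) - h%:C *: (a *: v + w) =
    a *: (U h x - x - h%:C *: v) + (U h y - y - h%:C *: w).
  rewrite semigroupD // semigroupZ // !scalerBr !scalerDr !opprD !scalerA.
  by rewrite [h%:C * a]mulrC [in RHS]addrACA; congr (_ + _); exact: addrACA.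
apply: le_trans (rnormD _ _) _; rewrite rnormZ.
have := hd2 h h0 hlt2; have := hd1 h h0 hlt1.
rewrite [e / 2 / _ * h]mulrAC ler_pdivlMr // mulrDr mulr1.
have := rnorm_ge0 (U h x - x - h%:C *: v); lra.
Qed.

End Semigroup.

(** * Riemann sums of derivatives *)

Section RiemannSums.
Context {R : realType} {V : normedModType R[i]}.
Implicit Types (F g : R -> V) (t : R).

Lemma deriv_on_subset (a b a' b' s : R) F v : a <= a' -> b' <= b ->
  deriv_on a b F s v -> deriv_on a' b' F s v.
Proof.
move=> aa' bb' Fs e e0; have [d d0 hd] := Fs e e0; exists d => // r /andP[ar rb].
by apply: hd; rewrite (le_trans aa' ar) (le_trans rb bb').
Qed.

(** The increment of [F] telescopes over the partition; on each cell the mean value inequality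
    compares it with the value of [g] at the left endpoint. *)
Lemma riemann_sum_deriv F g t : 0 <= t ->
  (forall s, 0 <= s <= t -> deriv_on 0 t F s (g s)) ->
  (forall e : R, 0 < e -> exists2 d : R, 0 < d & forall r s,
     0 <= r <= t -> 0 <= s <= t -> `|r - s| < d -> rnorm (g r - g s) <= e) ->
  integral_0t_is g t (F t - F 0).
Proof.
move=> t0 Fg gc; apply/cvg_rnormP => e e0.
pose e' := e / (t + 1).
have e'0 : 0 < e' by rewrite divr_gt0 //; lra.
have e't : e' * t <= e.
  rewrite /e' -mulrA ger_pMr // mulrC ler_pdivrMr; lra.
have [d d0 hd] := gc e' e'0.
(* This makes the mesh [h] smaller than [d]. *)
exists (Num.bound (t / d)) => // n /= nb.
pose h := t / n.+1%:R.
have n0 : 0 < n.+1%:R :> R by rewrite ltr0n.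
have h0 : 0 <= h by rewrite divr_ge0 // ltW.
have hd' : h < d.
  rewrite /h ltr_pdivrMr // mulrC -ltr_pdivrMr //.
  apply: lt_le_trans (archi_boundP _) _; first by rewrite divr_ge0 // ltW.
  by rewrite ler_nat leqW.
have hn : n.+1%:R * h = t by rewrite /h mulrC divfK // gt_eqF.
have -> : F t - F 0 = \sum_(k < n.+1) (F (k.+1%:R * h) - F (k%:R * h)).
  rewrite -(big_mkord xpredT (fun k => F (k.+1%:R * h) - F (k%:R * h))).
  by rewrite telescope_sumr // hn mul0r.
rewrite rnorm_distC /riemann_sum scaler_sumr -sumrB.
apply: le_trans (rnorm_sum _) _.
apply: le_trans (_ : \sum_(k < n.+1) e' * h <= e); last first.
  by rewrite sumr_const card_ord -mulr_natl mulrCA hn.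
apply: ler_sum => k _.
have kh0 : 0 <= k%:R * h by rewrite mulr_ge0.
have kh1 : k.+1%:R * h <= t by rewrite -hn ler_wpM2r // ler_nat.
have kE : k.+1%:R * h = k%:R * h + h by rewrite -natr1 mulrDl mul1r.
rewrite -mulrA -/h.
have := @mean_value_affine R V (k%:R * h) (k.+1%:R * h) F (g (k%:R * h)) e'.
have -> : k.+1%:R * h - k%:R * h = h by rewrite kE addrAC subrr add0r.
apply; first by rewrite kE lerDl.
move=> s /andP[ks sk]; exists (g s).
  by apply: deriv_on_subset (Fg s _) => //; lra.
by apply: hd; [lra|lra|rewrite ger0_norm; lra].
Qed.

Lemma riemann_sumB F g t n :
  riemann_sum (fun s => F s - g s) t n = riemann_sum F t n - riemann_sum g t n.
Proof. by rewrite /riemann_sum sumrB scalerBr. Qed.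

Lemma riemann_sum_bound g t n (C : R) : 0 <= t ->
  (forall s, 0 <= s <= t -> rnorm (g s) <= C) ->
  rnorm (riemann_sum g t n) <= t * C.
Proof.
move=> t0 gC; rewrite /riemann_sum rnormZr.
have n0 : 0 < n.+1%:R :> R by rewrite ltr0n.
have h0 : 0 <= t / n.+1%:R by rewrite divr_ge0 // ltW.
rewrite ger0_norm //.
have : rnorm (\sum_(k < n.+1) g (k%:R * t / n.+1%:R)) <= n.+1%:R * C.
  apply: le_trans (rnorm_sum _) _.
  apply: le_trans (_ : \sum_(k < n.+1) C <= _); last first.
    by rewrite sumr_const card_ord mulr_natl.
  apply: ler_sum => k _; apply: gC.
  apply/andP; split; first by rewrite divr_ge0 ?mulr_ge0.
  by rewrite ler_pdivrMr // mulrC ler_wpM2l // ler_nat ltnW.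
move=> /(ler_wpM2l h0)/le_trans; apply.
by rewrite mulrA divfK // gt_eqF.
Qed.

Lemma has_deriv_nonneg_of_deriv_on F t v : 0 <= t ->
  deriv_on 0 (t + 1) F t v -> has_deriv_nonneg F t v.
Proof.
move=> t0 Ft; apply/cvg_rnormP => e e0; have [d d0 hd] := Ft e e0.
(* The bound 1 keeps [t + h] inside [[0, t + 1]], where the derivative is known. *)
exists (Num.min d 1) => /=; first by rewrite lt_min d0 ltr01.
move=> h /=; rewrite sub0r normrN lt_min => /andP[hd' h1] [hn0 th].
have hp : 0 < `|h| by rewrite normr_gt0.
have -> : (h^-1)%:C *: (F (t + h) - F t) - v = (h^-1)%:C *: (F (t + h) - F t - h%:C *: v).
  by rewrite [in RHS]scalerBr scalerA -rmorphM mulVf // scale1r.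
rewrite rnormZr normfV ler_pdivrMl // mulrC.
have := hd (t + h); have -> : t + h - t = h by lra.
by apply => //; rewrite th lerD2l; have := ler_norm h; lra.
Qed.

Lemma deriv_on_linear (a b s C : R) F v (B : V -> V) :
  (forall x y, B (x - y) = B x - B y) -> (forall (c : R[i]) x, B (c *: x) = c *: B x) ->
  (forall x, rnorm (B x) <= C * rnorm x) ->
  deriv_on a b F s v -> deriv_on a b (fun r => B (F r)) s (B v).
Proof.
move=> BB BZ BC Fs e e0.
have C0 : 0 < `|C| + 1 by rewrite ltr_wpDl.
have [|d d0 hd] := Fs (e / (`|C| + 1)); first by rewrite divr_gt0.
exists d => // r rab rs; rewrite -BB -BZ -BB; apply: le_trans (BC _) _.
apply: le_trans (_ : (`|C| + 1) * rnorm (F r - F s - (r - s)%:C *: v) <= _).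
  by rewrite ler_wpM2r ?rnorm_ge0 //; have := ler_norm C; lra.
by rewrite mulrC -ler_pdivlMr // mulrAC; exact: hd.
Qed.

End RiemannSums.

(** * Interpolation between two semigroups *)

Section TwoSemigroups.
Context {R : realType} {V : completeNormedModType R[i]}.
Variables (U G : R -> V -> V) (hU : C0_semigroup U) (hG : C0_semigroup G).

(** Product rule: differentiating [G (t - r) x] contributes [- U s (G (t - s) q)], which cancels
    against the same term from differentiating [U], and only [b] survives. *)
Lemma deriv_on_interpolation t s x q b : 0 <= s <= t ->
  generator G x q -> generator U (G (t - s) x) (G (t - s) q + b) ->
  deriv_on 0 t (fun r => U r (G (t - r) x)) s (U s b).
Proof.
move=> st gx gy e e0; set y := G (t - s) x in gy *; set p := G (t - s) q in gy.
have [M M1 hM] := semigroup_bounded hU t.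
have e30 : 0 < e / 3 by rewrite divr_gt0.
have e3M : 0 < e / 3 / M by rewrite divr_gt0 //; lra.
have ts : 0 <= t - s <= t by lra.
have [d1 d10 hd1] := orbit_deriv hG gx ts e3M.
have [d2 d20 hd2] := orbit_deriv hU gy st e30.
have [d3 d30 hd3] := @orbit_unif_continuous _ _ _ hU t p _ e30.
exists (Num.min d1 (Num.min d2 d3)); first by rewrite !lt_min d10 d20.
move=> r rt; rewrite !lt_min => /and3P[rd1 rd2 rd3].
have {hd1}h1 : rnorm (U r (G (t - r) x - y + (r - s)%:C *: p)) <= e / 3 * `|r - s|.
  apply: le_trans (hM _ _ rt) _; rewrite mulrC -ler_pdivlMr; last lra.
  rewrite mulrAC; have := hd1 (t - r).
  have -> : t - r - (t - s) = - (r - s) by lra.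
  rewrite normrN rmorphN scaleNr opprK; apply => //; lra.
have {hd2}h2 := hd2 r rt rd2.
have {hd3}h3 : rnorm ((r - s)%:C *: (U r p - U s p)) <= e / 3 * `|r - s|.
  by rewrite rnormZr mulrC ler_wpM2r //; exact: hd3.
have r0 : 0 <= r by lra.
have s0 : 0 <= s by lra.
(* Three errors: the expansion of the [G]-orbit seen through [U r], the expansion of the [U]-orbit
   of the fixed [y], and the replacement of [U r p] by [U s p]. *)
have -> : U r (G (t - r) x) - U s y - (r - s)%:C *: U s b =
    U r (G (t - r) x - y + (r - s)%:C *: p) +
    (U r y - U s y - (r - s)%:C *: U s (p + b)) -
    (r - s)%:C *: (U r p - U s p).
  rewrite (semigroupD hU (_ - y)) // (semigroupB hU) // (semigroupZ hU) //.
  rewrite (semigroupD hU p) // scalerBr scalerDr.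
  rewrite [RHS]addrAC opprB -[X in _ = X + _]addrA [_ *: U r p + _]addrC subrK.
  by rewrite opprD [RHS]addrACA subrKA addNKr.
apply: le_trans (rnormB _ _) _.
apply: le_trans (lerD (rnormD _ _) (lexx _)) _.
move: h1 h2 h3; lra.
Qed.

End TwoSemigroups.

(** * The scalar product and the projections *)

Section InnerProduct.
Context {R : realType} {V : normedModType R[i]}.
Variables (ip : V -> V -> R[i]) (hip : inner_product ip).
Implicit Types (x y u z : V) (c : R[i]).

Lemma ipD x y u : ip (x + y) u = ip x u + ip y u.
Proof. by case: hip => h _ _; have := h 1 x y u; rewrite scale1r mul1r. Qed.

Lemma ip0 u : ip 0 u = 0.
Proof. by apply: (addrI (ip 0 u)); rewrite -ipD !addr0. Qed.

Lemma ipZ c x u : ip (c *: x) u = c * ip x u.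
Proof. by case: hip => h _ _; have := h c x 0 u; rewrite !addr0 ip0 addr0. Qed.

Lemma ipB x y u : ip (x - y) u = ip x u - ip y u.
Proof. by rewrite ipD -scaleN1r ipZ mulN1r. Qed.

Lemma ip_conj x y : ip y x = (ip x y)^*.
Proof. by case: hip. Qed.

Lemma ipBr u x y : ip u (x - y) = ip u x - ip u y.
Proof. by rewrite ip_conj ipB rmorphB /= -!ip_conj. Qed.

Lemma ipZr c u x : ip u (c *: x) = c^* * ip u x.
Proof. by rewrite ip_conj ipZ rmorphM /= -ip_conj. Qed.

Lemma ip_norm x : ip x x = `|x| ^+ 2.
Proof. by case: hip. Qed.

Lemma ip_eq0 z : z != 0 -> ip z z != 0.
Proof. by move=> z0; rewrite ip_norm expf_neq0 // normr_eq0. Qed.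

(** The component [y] of [x] orthogonal to [u] has a nonnegative square norm. *)
Lemma cauchy_schwarz x u : `|ip x u| <= `|x| * `|u|.
Proof.
have [->|u0] := eqVneq u 0.
  by rewrite ip_conj ip0 conjc0 !normr0 mulr0.
have uu := ip_eq0 u0.
have uu0 : 0 < `|u| ^+ 2 by rewrite exprn_gt0 // normr_gt0.
pose y := x - (ip x u / ip u u) *: u.
have yu : ip y u = 0 by rewrite /y ipB ipZ divfK // subrr.
have yy : ip y y = `|x| ^+ 2 - `|ip x u| ^+ 2 / `|u| ^+ 2.
  rewrite {2}/y ipBr ipZr yu mulr0 subr0 /y ipB ipZ ip_norm sqr_normc -ip_norm.
  by rewrite (ip_conj x u) mulrAC (ip_norm u).
have : 0 <= ip y y by rewrite ip_norm exprn_ge0.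
rewrite yy subr_ge0 ler_pdivrMr // -exprMn.
by rewrite ler_sqr // nnegrE ?mulr_ge0.
Qed.

(** One bound for all the rank-one operators that occur: [projP], [B], and the operator built from
    [Ldz]. *)
Lemma rnorm_ip_scale x u c z :
  rnorm ((ip x u / c) *: z) <= rnorm u * complex.Re `|c^-1| * rnorm z * rnorm x.
Proof.
rewrite rnormZ.
have -> : complex.Re `|ip x u / c| = complex.Re `|ip x u| * complex.Re `|c^-1|.
  rewrite normrM {1}(ge0_complexE (normr_ge0 (ip x u))).
  by rewrite {1}(ge0_complexE (normr_ge0 c^-1)) -rmorphM.
have : complex.Re `|ip x u| <= rnorm x * rnorm u.
  by have := cauchy_schwarz x u; rewrite lecE => /andP[_]; rewrite !normE -rmorphM.
move=> /(ler_wpM2r (mulr_ge0 (Re_norm_ge0 c^-1) (rnorm_ge0 z))).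
by rewrite mulrA => /le_trans; apply; rewrite [leRHS]mulrC !mulrA.
Qed.

Lemma projPB z x y : projP ip z (x - y) = projP ip z x - projP ip z y.
Proof. by rewrite /projP ipB mulrBl scalerBl. Qed.

Lemma projPZ z c x : projP ip z (c *: x) = c *: projP ip z x.
Proof. by rewrite /projP ipZ scalerA mulrA. Qed.

Lemma projQB z x y : projQ ip z (x - y) = projQ ip z x - projQ ip z y.
Proof. by rewrite /projQ projPB subrACA. Qed.

Lemma projQ_perp z x : z != 0 -> ip (projQ ip z x) z = 0.
Proof. by move=> z0; rewrite /projQ ipB /projP ipZ divfK ?subrr // ip_eq0. Qed.

Lemma projQ_id z x : ip x z = 0 -> projQ ip z x = x.
Proof. by move=> xz; rewrite /projQ /projP xz mul0r scale0r subr0. Qed.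

Lemma projP_bounded z : exists2 C : R, 0 <= C &
  forall x, rnorm (projP ip z x) <= C * rnorm x.
Proof.
exists (rnorm z * complex.Re `|(ip z z)^-1| * rnorm z); last first.
  by move=> x; exact: rnorm_ip_scale.
by rewrite !mulr_ge0 ?rnorm_ge0 ?Re_norm_ge0.
Qed.

Lemma projQ_bounded z : exists2 C : R, 0 <= C &
  forall x, rnorm (projQ ip z x) <= C * rnorm x.
Proof.
have [C C0 hC] := projP_bounded z; exists (1 + C); first lra.
by move=> x; apply: le_trans (rnormB _ _) _; have := hC x; lra.
Qed.

End InnerProduct.

Lemma op_closureP (R : realType) (V : normedModType R[i]) (A : opgraph V) x y :
  op_closure A x y -> forall e : R, 0 < e ->
  exists x' y', [/\ A x' y', rnorm (x' - x) <= e & rnorm (y' - y) <= e].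
Proof.
move=> cl e e0.
have ec0 : 0 < e%:C :> R[i] by rewrite ltcR.
have nb : nbhs (x, y) [set p : V * V | rnorm (p.1 - x) <= e /\ rnorm (p.2 - y) <= e].
  exists (ball x e%:C, ball y e%:C); first by split; exact: nbhsx_ballx.
  move=> [p q] /= []; rewrite -!ball_normE /= (distrC x) (distrC y) !normE !ltcR.
  by move=> /ltW ? /ltW.
by have [[p q] /= [Apq [hp hq]]] := cl _ nb; exists p, q.
Qed.

(** * The projected dynamics and the memory integral *)

Section MemoryEquation.
Context {R : realType} {V : completeNormedModType R[i]}.
Variables (ip : V -> V -> R[i]) (hip : inner_product ip).
Variables (U : R -> V -> V) (hU : C0_semigroup U).
Variables (z Lz Ldz : V) (z0 : z != 0).
Hypothesis hLz : generator U z Lz.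
Hypothesis hLdz : adjoint ip (generator U) z Ldz.
Variables (G : R -> V -> V) (hG : C0_semigroup G).
Hypothesis hGgen : forall x y, generator G x y <-> opQLbarQ ip z (generator U) x y.
Implicit Types (x y v : V) (s t : R).

(* Agrees with PL on the vectors of D(L) orthogonal to z. *)
Let B x := (ip x (projQ ip z Ldz) / ip z z) *: z.

Let B_bounded : exists2 C : R, 0 <= C & forall x, rnorm (B x) <= C * rnorm x.
Proof.
exists (rnorm (projQ ip z Ldz) * complex.Re `|(ip z z)^-1| * rnorm z); last first.
  by move=> x; exact: rnorm_ip_scale.
by rewrite !mulr_ge0 ?rnorm_ge0 ?Re_norm_ge0.
Qed.

Let BB x y : B (x - y) = B x - B y.
Proof. by rewrite /B (ipB hip) mulrBl scalerBl. Qed.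

Lemma ip_projQr x : ip x z = 0 -> ip x (projQ ip z Ldz) = ip x Ldz.
Proof. by move=> xz; rewrite /projQ /projP (ipBr hip) (ipZr hip) xz mulr0 subr0. Qed.

(** The range of QL is orthogonal to [z], and by Cauchy-Schwarz this passes to limits. *)
Lemma projected_generator_perp x v : generator G x v -> ip v z = 0.
Proof.
move=> /hGgen/op_closureP cl; apply/eqP; rewrite -normr_eq0.
have h (e : R) : 0 < e -> `|ip v z| <= (e * rnorm z)%:C.
  move=> e0; have [x' [y' [[w [_ ->]] _ vw]]] := cl e e0.
  have -> : ip v z = ip (v - projQ ip z w) z.
    by rewrite (ipB hip) projQ_perp // subr0.
  apply: le_trans (cauchy_schwarz hip _ _) _.
  by rewrite !normE -rmorphM lecR ler_wpM2r ?rnorm_ge0 // rnorm_distC.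
rewrite (ge0_complexE (normr_ge0 _)); set r := complex.Re _.
have r0 : r <= 0.
  have z1 : 0 < rnorm z + 1 by have := rnorm_ge0 z; lra.
  apply/ler_addgt0Pr => e e0; rewrite add0r.
  have /h : 0 < e / (rnorm z + 1) by rewrite divr_gt0.
  rewrite lecE => /andP[_] /le_trans; apply.
  by rewrite /= mulrAC ler_pdivrMr // ler_pM2l //; lra.
by have := normr_ge0 (ip v z); rewrite lecE => /andP[_ /= r0']; rewrite eq_le lecR r0 lecR.
Qed.

(** If [x'] tends to [x] and [projQ ip z w] to [v], then the missing component of [w] along [z],
    governed by [ip x' Ldz], converges too; closedness of the generator of [U] concludes. *)
Lemma generator_of_projected x v : ip x z = 0 -> generator G x v -> generator U x (v + B x).
Proof.
move=> xz gx; have vz := projected_generator_perp gx.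
move/hGgen: gx; rewrite /opQLbarQ (projQ_id xz) => /op_closureP cl.
have hC y := rnorm_ip_scale hip y Ldz (ip z z) z.
move: hC; set C := (_ * _ * _) => hC.
have C0 : 0 <= C by rewrite !mulr_ge0 ?rnorm_ge0 ?Re_norm_ge0.
have C1 : 0 < C + 1 by lra.
apply: (generator_closed hU) => e e0.
have eC : 0 < e / (C + 1) by rewrite divr_gt0.
have eCe : (C + 1) * (e / (C + 1)) = e by rewrite mulrC divfK // gt_eqF.
have [x' [_ [[w [gx' ->]] xx' vw]]] := cl _ eC.
have Ce : 0 <= C * (e / (C + 1)) by rewrite mulr_ge0 // ltW.
exists x', w; split=> //; first by apply: le_trans xx' _; lra.
(* The adjoint relation gives [ip w z = ip x' Ldz]. The approximant [x'] need not be orthogonal to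
   [z], so [Ldz] itself appears rather than its projection. *)
have -> : w - (v + B x) = (projQ ip z w - v) + (ip (x' - x) Ldz / ip z z) *: z.
  rewrite /B ip_projQr // (ipB hip) -(hLdz gx') mulrBl scalerBl /projQ.
  by rewrite -/(projP ip z w) [w - _ - v]addrAC subrKA opprD addrA.
apply: le_trans (rnormD _ _) _; have := hC (x' - x).
have := ler_wpM2l C0 xx'; lra.
Qed.

Lemma projected_of_generator x v : ip x z = 0 -> generator U x v ->
  generator G x (projQ ip z v).
Proof.
move=> xz gx; apply/hGgen; rewrite /opQLbarQ (projQ_id xz).
by apply: subset_closure; exists v.
Qed.

(** The curve [projP ip z (G r x)] starts at 0 and has derivative [projP ip z (G r v)], which
    vanishes because [G r v] is in the range of the generator of [G]. *)
Lemma projected_orbit_perp x v s : ip x z = 0 -> generator G x v -> 0 <= s ->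
  ip (G s x) z = 0.
Proof.
move=> xz gx s0.
have [C C0 hC] := projP_bounded hip z.
have := @mean_value_affine R V 0 s (fun r => projP ip z (G r x)) 0 0 s0.
case: hG => _ _ -> _ _; rewrite scaler0 subr0 mul0r.
have -> : projP ip z x = 0 by rewrite /projP xz mul0r scale0r.
rewrite subr0 => h.
have /rnorm0_eq0 : rnorm (projP ip z (G s x)) = 0.
  apply/eqP; rewrite eq_le rnorm_ge0 andbT; apply: h => r /andP[r0 rs].
  exists (projP ip z (G r v)).
    apply: (deriv_on_linear (C := C)) => //; [exact: projPB|exact: projPZ|].
    by apply: (orbit_deriv hG) => //; rewrite r0.
  have /projected_generator_perp := generator_invariant hG r0 gx.
  by rewrite /projP => ->; rewrite mul0r scale0r subr0 rnorm0.
move/eqP; rewrite /projP scaler_eq0 (negPf z0) orbF mulf_eq0 invr_eq0.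
by rewrite (negPf (ip_eq0 hip z0)) orbF => /eqP.
Qed.

(** The memory integrand with a general vector [x] in place of [projQ ip z Lz]. *)
Let g t x s := (ip (G (t - s) x) (projQ ip z Ldz) / ip z z) *: U s z.

Let gE t x s : 0 <= s -> g t x s = U s (B (G (t - s) x)).
Proof. by move=> s0; rewrite /B (semigroupZ hU). Qed.

Lemma memory_integral_domain t x v : 0 <= t -> ip x z = 0 -> generator U x v ->
  integral_0t_is (g t x) t (U t x - G t x).
Proof.
move=> t0 xz gUx; have gGx := projected_of_generator xz gUx.
pose F r := U r (G (t - r) x).
have -> : U t x - G t x = F t - F 0.
  by rewrite /F subrr subr0; case: hU => _ _ -> _ _; case: hG => _ _ -> _ _.
apply: (@riemann_sum_deriv _ _ F) => // [s st|e e0].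
  have s0 : 0 <= s by lra.
  rewrite gE //; apply: (deriv_on_interpolation hU hG st gGx).
  have ts : 0 <= t - s by lra.
  (* Orthogonality to [z] and membership in the domain persist along the [G]-orbit, so at
     [G (t - s) x] the two generators differ exactly by [B]. *)
  apply: generator_of_projected; first exact: projected_orbit_perp gGx _.
  exact: generator_invariant.
have [C C0 hC] := B_bounded.
have [M M1 hM] := semigroup_bounded hU t.
have [N N1 hN] := semigroup_bounded hG t.
pose E := rnorm (projQ ip z Ldz) * complex.Re `|(ip z z)^-1| * (N * rnorm x).
have E0 : 0 <= E by rewrite !mulr_ge0 ?rnorm_ge0 ?Re_norm_ge0 //; lra.
have MC : 0 <= M * C by rewrite mulr_ge0 //; lra.
have e1 : 0 < e / 2 / (M * C + 1) by rewrite !divr_gt0 //; lra.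
have e2 : 0 < e / 2 / (E + 1) by rewrite !divr_gt0 //; lra.
have [d1 d10 hd1] := @orbit_unif_continuous _ _ _ hG t x _ e1.
have [d2 d20 hd2] := @orbit_unif_continuous _ _ _ hU t z _ e2.
exists (Num.min d1 d2); first by rewrite lt_min d10.
move=> r s rt st; rewrite lt_min => /andP[rs1 rs2].
have r0 : 0 <= r by lra.
(* The first term is controlled by continuity of the [G]-orbit of [x], the second by that of the
   [U]-orbit of [z], with [E] bounding the scalar factor. *)
have -> : g t x r - g t x s = U r (B (G (t - r) x - G (t - s) x)) +
    (ip (G (t - s) x) (projQ ip z Ldz) / ip z z) *: (U r z - U s z).
  by rewrite BB (semigroupB hU) // -gE // scalerBr [in RHS]/B (semigroupZ hU) // subrKA.
apply: le_trans (rnormD _ _) _.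
have h1 : rnorm (G (t - r) x - G (t - s) x) <= e / 2 / (M * C + 1).
  apply: hd1; [lra|lra|].
  have -> : t - r - (t - s) = - (r - s) by lra.
  by rewrite normrN.
have h2 : rnorm (U r (B (G (t - r) x - G (t - s) x))) <= e / 2.
  apply: le_trans (hM _ _ rt) _.
  apply: le_trans (ler_wpM2l _ (hC _)) _; first lra.
  rewrite mulrA; apply: le_trans (ler_wpM2l MC h1) _.
  by rewrite mulrCA ger_pMr ?divr_gt0 // ler_pdivrMr; lra.
have h3 := rnorm_ip_scale hip (G (t - s) x) (projQ ip z Ldz) (ip z z) (U r z - U s z).
have h4 : rnorm (projQ ip z Ldz) * complex.Re `|(ip z z)^-1| *
    rnorm (U r z - U s z) * rnorm (G (t - s) x) <= E * rnorm (U r z - U s z).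
  rewrite mulrAC /E ler_wpM2r ?rnorm_ge0 // ler_wpM2l ?mulr_ge0 ?rnorm_ge0 ?Re_norm_ge0 //.
  by apply: hN; lra.
have h5 : E * rnorm (U r z - U s z) <= e / 2.
  apply: le_trans (ler_wpM2l E0 (hd2 _ _ rt st rs2)) _.
  by rewrite mulrCA ger_pMr ?divr_gt0 // ler_pdivrMr; lra.
lra.
Qed.

(** The Riemann sums are linear in the vector and bounded by a constant that does not depend on [n],
    so one approximant [x] serves all fine partitions. *)
Lemma memory_integral_closure t w : 0 <= t ->
  (forall e : R, 0 < e -> exists x, rnorm (x - w) <= e /\
     integral_0t_is (g t x) t (U t x - G t x)) ->
  integral_0t_is (g t w) t (U t w - G t w).
Proof.
move=> t0 app; apply/cvg_rnormP => e e0.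
have [C C0 hC] := B_bounded.
have [M M1 hM] := semigroup_bounded hU t.
have [N N1 hN] := semigroup_bounded hG t.
(* The product bounds the Riemann sum as an operator, [M] bounds [U t] and [N] bounds [G t]. *)
pose D := t * (M * (C * N)) + M + N.
have CN : 0 <= C * N by rewrite mulr_ge0; lra.
have tD : 0 <= t * (M * (C * N)) by rewrite !mulr_ge0 //; lra.
have D0 : 0 < D by rewrite /D; lra.
have [|x [xw ix]] := app (e / 2 / D); first by rewrite !divr_gt0.
have e20 : 0 < e / 2 by rewrite divr_gt0.
move/cvg_rnormP: ix => /(_ _ e20); apply: filterS => n hn.
have h1 : rnorm (riemann_sum (g t w) t n - riemann_sum (g t x) t n) <=
    t * (M * (C * (N * rnorm (x - w)))).
  rewrite -riemann_sumB; apply: riemann_sum_bound => // s st.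
  have s0 : 0 <= s by lra.
  have ts : 0 <= t - s by lra.
  rewrite !gE // -(semigroupB hU) // -BB -(semigroupB hG) // [rnorm (x - w)]rnorm_distC.
  apply: le_trans (hM _ _ st) _; rewrite ler_wpM2l //; first lra.
  apply: le_trans (hC _) _; rewrite ler_wpM2l //.
  by apply: hN; lra.
have tt : 0 <= t <= t by rewrite t0 lexx.
have h2 := hM t (x - w) tt; have h3 := hN t (x - w) tt.
have h4 : rnorm ((U t x - G t x) - (U t w - G t w)) <= (M + N) * rnorm (x - w).
  rewrite subrACA -(semigroupB hU) // -(semigroupB hG) //.
  by apply: le_trans (rnormB _ _) _; lra.
have h5 : D * rnorm (x - w) <= e / 2.
  by rewrite mulrC -ler_pdivlMr.
have h6 := rnorm_distD (riemann_sum (g t x) t n) (riemann_sum (g t w) t n) (U t w - G t w).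
have h7 := rnorm_distD (U t x - G t x) (riemann_sum (g t x) t n) (U t w - G t w).
move: h5; rewrite /D; lra.
Qed.

(** The vector [projQ ip z Lz] may lie outside the domain of the generator of [U], whereas the
    projected difference quotients of the orbit of [z] lie inside it. *)
Lemma memory_integral t : 0 <= t ->
  integral_0t_is (g t (projQ ip z Lz)) t
    (U t (projQ ip z Lz) - G t (projQ ip z Lz)).
Proof.
move=> t0; apply: memory_integral_closure => // e e0.
have [C C0 hC] := projQ_bounded hip z.
have C1 : 0 < C + 1 by lra.
have eC : 0 < e / (C + 1) by rewrite divr_gt0.
have [d d0 hd] := (cvg_at_right0P _ _).1 hLz _ eC.
have d2 : 0 < d / 2 by lra.
pose a := ((d / 2)^-1)%:C : R[i].
pose q := a *: (U (d / 2) z - z).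
exists (projQ ip z q); split.
  rewrite -(projQB hip); apply: le_trans (hC _) _.
  apply: le_trans (_ : (C + 1) * rnorm (q - Lz) <= _).
    by rewrite ler_wpM2r ?rnorm_ge0 //; lra.
  by rewrite mulrC -ler_pdivlMr //; apply: hd; lra.
(* The right side is shaped for two uses of [generator_linear]; the coefficient is lowered by 1 to
   make up for the trailing [z]. *)
have qE : projQ ip z q =
    a *: U (d / 2) z + ((- (ip q z / ip z z) - a - 1) *: z + z).
  rewrite !scalerBl scaleNr scale1r subrK /projQ /projP {1}/q scalerBr.
  by rewrite -addrA [- _ - _]addrC.
have gUz := generator_invariant hU (ltW d2) hLz.
have := generator_linear hU (a := a) gUz
  (generator_linear hU (a := - (ip q z / ip z z) - a - 1) hLz hLz).
rewrite -qE => gq; apply: memory_integral_domain gq => //; exact: projQ_perp.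
Qed.

End MemoryEquation.

Theorem theorem1 (R : realType) (V : completeNormedModType R[i])
  (ip : V -> V -> R[i]) (hip : inner_product ip)
  (U : R -> V -> V) (hU : C0_semigroup U)
  (z Lz Ldz : V) (hz0 : z != 0)
  (hLz : generator U z Lz)
  (hLdz : adjoint ip (generator U) z Ldz)
  (G : R -> V -> V) (hG : C0_semigroup G)
  (hGgen : forall x y, generator G x y <-> opQLbarQ ip z (generator U) x y) :
  let K := fun t : R => ip (G t (projQ ip z Lz)) (projQ ip z Ldz) / ip z z in
  forall t : R, 0 <= t ->
    (exists y, generator U (U t z) y) /\
    exists I : V,
      integral_0t_is (fun s => K (t - s) *: U s z) t I /\
      has_deriv_nonneg (fun s => U s z) t
        (U t (projP ip z Lz) + G t (projQ ip z Lz) + I).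
Proof.
move=> K t t0; split.
  by exists (U t Lz); exact: generator_invariant.
exists (U t (projQ ip z Lz) - G t (projQ ip z Lz)); split.
  exact: memory_integral.
have -> : U t (projP ip z Lz) + G t (projQ ip z Lz) +
    (U t (projQ ip z Lz) - G t (projQ ip z Lz)) = U t Lz.
  rewrite addrACA subrr addr0 -(semigroupD hU) //.
  by rewrite /projQ addrC subrK.
apply: has_deriv_nonneg_of_deriv_on => //.
by apply: (orbit_deriv hU hLz); lra.
Qed.
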